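(* Let $(a_n)_{n\ge1}$ and $(b_n)_{n\ge1}$ be sequences of natural numbers such that $b_1=a_2$ and $a_nb_{n+1}-b_na_{n+1}=1$ for all $n\in\mathbb N$. There exists an infinite matrix $T=(t_{ij})_{i,j=1}^{\infty}$ with the following properties: \begin{enumerate} \item $t_{ij}\in\mathbb N$ for all $i,j\in\mathbb N$; \item $t_{ij}=t_{ji}$ for all $i,j\in\mathbb N$; \item $t_{1n}=t_{n1}=a_n$ for all $n\in\mathbb N$, and $t_{2n}=t_{n2}=b_n$ for all $n\in\mathbb N$; \item for each $n\in\mathbb N$, all minors of $T^{(n)}$ are positive (i.e. $T^{(n)}$ is totally positive); \item for each $n\in\mathbb N$, $\Delta(T^{(n)})_{\{n\},\{1\}}=t_{n1}=a_n$, and for each $k$ with $2\le k\le n$, $$\Delta(T^{(n)})_{\{n,n-1,\ldots,n-k+1\},\{1,2,\ldots,k\}}=1;$$ in particular $\det T^{(n)}=1$ for $n\ge2$ (i.e. all solid minors of $T^{(n)}$ whose lower-left corner coincides with the lower-left corner of $T^{(n)}$, except possibly $\Delta(T^{(n)})_{\{n\},\{1\}}$, are equal to $1$). \end{enumerate}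
   Context: $\mathbb N=\{1,2,3,\ldots\}$. For an infinite matrix $T=(t_{ij})_{i,j=1}^\infty$ and $n\in\mathbb N$, $T^{(n)}=(t_{ij})_{i,j=1}^n$ is its upper-left $n\times n$ corner. For an $n\times n$ matrix $S=(s_{ij})$ and sets $I,J\subseteq\{1,\ldots,n\}$ of equal cardinality, $\Delta(S)_{I,J}$ is the minor $\det (s_{ij})_{i\in I,j\in J}$, with rows and columns taken in increasing order. A minor is solid if both $I$ and $J$ consist of consecutive indices. A square matrix is totally positive if all its minors are positive real numbers. *)

(* Defs.v *)
From mathcomp Require Import all_boot all_order all_algebra.

Set Implicit Arguments.
Unset Strict Implicit.
Unset Printing Implicit Defensive.

Import Order.TTheory GRing.Theory Num.Theory.
Local Open Scope ring_scope.

(* Sequences and infinite matrices are indexed by {1, 2, ...}: their values at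
   index 0 are junk. An ordinal i : 'I_n stands for the index i.+1 of
   {1, ..., n}. *)

Definition corner (R : Type) (T : nat -> nat -> R) (n : nat) : 'M[R]_n :=
  \matrix_(i < n, j < n) T i.+1 j.+1.

(* [enum] lists a set of ordinals in increasing order. When #|I| = #|J|, the
   default value of [nth] is never used. The empty minor is 1. *)
Definition minor (R : comNzRingType) (n : nat) (S : 'M[R]_n)
    (I J : {set 'I_n}) : R :=
  \det (\matrix_(i < #|I|, j < #|I|)
          S (enum_val i) (nth (enum_val i) (enum J) j)).

Definition totally_positive (R : realDomainType) (n : nat) (S : 'M[R]_n) :
    Prop :=
  forall I J : {set 'I_n}, #|I| = #|J| -> 0 < minor S I J.

(* The index set {p, p + 1, ..., q}, intersected with {1, ..., n}. *)
Definition index_range (n p q : nat) : {set 'I_n} :=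
  [set i : 'I_n | (p <= i.+1 <= q)%N].

Definition solid (n : nat) (I : {set 'I_n}) : Prop :=
  exists p q : nat, I = index_range n p q.

(* The submatrix with rows I and columns J has its lower-left entry in
   position (n, 1). *)
Definition lower_left (n : nat) (I J : {set 'I_n}) : Prop :=
  (exists2 i : 'I_n, i \in I & i.+1 = n) /\
  (exists2 j : 'I_n, j \in J & j.+1 = 1%N).

(* Main.v *)
(* With indices shifted to start at 0, write al_i = a_(i+1) and
   be_i = b_(i+1).  The matrix T is obtained from Pascal's matrix
   P_ij = C(i + j, i) in two rounds of double summation:
     U_ij = al_0 + \sum_(p < i) \sum_(q < j) al_(p+1) al_(q+1) P_pq,
     T_ij = al_i al_j (1 / al_0 + \sum_(p < i) \sum_(q < j)
              U_pq / (al_p al_(p+1) al_q al_(q+1))).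
   Positive scaling preserves total positivity, and so does passing from N to
   M_ij = c + \sum_(p < i) \sum_(q < j) N_pq with c > 0: after subtracting
   adjacent rows and columns in a minor of M, multilinearity expands it as a sum
   of minors of the block matrix c (+) N over interlacing index sets.  Pascal's
   matrix is its own double summation with c = 1, hence totally positive.  A
   minor of M on initial rows and consecutive columns is c times such a minor of
   N, so that the scaling factors of T telescope to 1.
   T is integral because both sums together invert, in each variable, the second
   order difference operator whose kernel is spanned by al and be, and the Green
   function al_(p+1) be_n - be_(p+1) al_n of this operator is integral. *)

Require Import Defs.
From mathcomp Require Import all_boot all_order all_algebra.
From mathcomp Require Import zify ring.

Set Implicit Arguments.
Unset Strict Implicit.
Unset Printing Implicit Defensive.

Import Order.TTheory GRing.Theory Num.Theory.
Local Open Scope ring_scope.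

(** * Partial sums of the rows of a determinant *)

(** Taking row differences is left multiplication by [E], which is lower unitriangular. *)
Lemma det_row_diff (R : comNzRingType) k (A : nat -> 'I_k -> R) :
  \det (\matrix_(i < k, j < k) (A i j - if (i : nat) is i'.+1 then A i' j else 0))
  = \det (\matrix_(i < k, j < k) A i j).
Proof.
pose E : 'M[R]_k := \matrix_(i, j) ((i == j)%:R - (i == j.+1 :> nat)%:R).
have detE : \det E = 1.
  rewrite det_trig.
    by apply: big1 => i _; rewrite mxE eqxx ltn_eqF // subr0.
  apply/is_trig_mxP => i j lt_ij; rewrite mxE -val_eqE /= !ltn_eqF ?subrr //.
  exact: ltnW.
rewrite -[RHS]mul1r -detE -det_mulmx; congr (\det _); apply/matrixP => i j.
rewrite !mxE.
under eq_bigr => l _ do rewrite !mxE mulrBl.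
rewrite sumrB; congr (_ - _).
  rewrite (bigD1 i) //= eqxx mul1r big1 ?addr0 // => l.
  by rewrite eq_sym => /negbTE->; rewrite mul0r.
case: i => -[|i] /= lt_ik; first by rewrite big1 // => l _; rewrite mul0r.
rewrite (bigD1 (Ordinal (ltnW lt_ik))) //= eqxx mul1r big1 ?addr0 // => l.
by rewrite -val_eqE eqSS /= eq_sym => /negbTE->; rewrite mul0r.
Qed.

(** Multilinearity in the rows: [h] picks one summand in each row. *)
Lemma det_sum_rows (R : comNzRingType) k n (Q : 'I_k -> pred 'I_n)
    (A : 'I_n -> 'I_k -> R) :
  \det (\matrix_(i, j) \sum_(p | Q i p) A p j) =
  \sum_(h in family Q) \det (\matrix_(i, j) A (h i) j).
Proof.
rewrite /determinant exchange_big /=; apply: eq_bigr => s _.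
under eq_bigr => i _ do rewrite mxE.
rewrite bigA_distr_big_dep /= mulr_sumr; apply: eq_bigr => h _.
by congr (_ * _); apply: eq_bigr => i _; rewrite mxE.
Qed.

Definition increasing k (f : nat -> nat) :=
  forall i j, (i < j)%N -> (j < k)%N -> (f i < f j)%N.

(** Differencing the partial sums along [f] leaves in row [i] the block of indices from
    [prev_bound f i] to [f i]. *)
Definition prev_bound (f : nat -> nat) i := if i is i'.+1 then (f i').+1 else 0%N.

Lemma det_partial_sums (R : comNzRingType) k n (A : nat -> 'I_k -> R) f :
    increasing k f -> (forall i, (i < k)%N -> (f i < n)%N) ->
  \det (\matrix_(i < k, j < k) \sum_(p < (f i).+1) A p j) =
  \sum_(h in family (fun (i : 'I_k) (p : 'I_n) => prev_bound f i <= p <= f i)%N)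
    \det (\matrix_(i < k, j < k) A (h i) j).
Proof.
move=> inc_f f_lt.
rewrite -(det_row_diff (fun i j => \sum_(p < (f i).+1) A p j)).
rewrite -(@det_sum_rows _ _ _ _ (fun p : 'I_n => A p)).
congr (\det _); apply/matrixP => i j; rewrite !mxE.
rewrite (big_ord_widen n (A^~ j)) ?f_lt //.
case: i => -[|i] lt_ik /=.
  by rewrite subr0; apply: eq_bigl => p; rewrite ltnS.
have lt_f : (f i < f i.+1)%N by apply: inc_f.
rewrite (big_ord_widen n (A^~ j)) ?f_lt //; last exact: ltnW.
rewrite (bigID (fun p : 'I_n => (p <= f i)%N)) /= addrC.
rewrite [X in _ + X - _](eq_bigl (fun p : 'I_n => (p < (f i).+1)%N)) ?addrK.
  by apply: eq_bigl => p; rewrite -ltnNge ltnS andbC.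
by move=> p /=; rewrite !ltnS; apply: andb_idl => /leq_trans->//; apply: ltnW.
Qed.

(** The blocks are disjoint and move up with the row, so every choice in them is increasing and
    contributes a nonnegative determinant; only the term of [h0] is kept. *)
Lemma det_partial_sums_ge (R : realDomainType) k (A : nat -> 'I_k -> R) f h0 :
    increasing k f ->
    (forall h, increasing k h -> (forall i, (i < k)%N -> (h i <= f i)%N) ->
       0 <= \det (\matrix_(i < k, j < k) A (h i) j)) ->
    (forall i, (i < k)%N -> (prev_bound f i <= h0 i <= f i)%N) ->
  \det (\matrix_(i < k, j < k) A (h0 i) j) <=
  \det (\matrix_(i < k, j < k) \sum_(p < (f i).+1) A p j).
Proof.
move=> inc_f A_ge0 h0P.
pose n := (\max_(i < k) f i).+1.
have f_lt i : (i < k)%N -> (f i < n)%N.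
  by move=> lt_ik; rewrite ltnS (leq_bigmax (Ordinal lt_ik)).
rewrite (det_partial_sums A inc_f f_lt).
have h0_lt (i : 'I_k) : (h0 i < n)%N.
  by have /andP[_ /leq_ltn_trans->] := h0P i (ltn_ord i); rewrite ?f_lt.
rewrite (bigD1 [ffun i => Ordinal (h0_lt i)]) /=; last first.
  by apply/familyP => i; rewrite ffunE; exact: h0P.
set x := \det _; set y := \det _; have -> : x = y.
  by congr (\det _); apply/matrixP => i j; rewrite !mxE ffunE.
rewrite lerDl sumr_ge0 // => h /andP[/familyP hP _].
(* Extension of [h] to [nat]; the default 0 is never read below [k]. *)
pose h' i := oapp (fun i => h i : nat) 0%N (insub i).
have h'E (i : 'I_k) : h' i = h i by rewrite /h' valK.
have h'P i : (i < k)%N -> (prev_bound f i <= h' i <= f i)%N.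
  by move=> lt_ik; have := hP (Ordinal lt_ik); rewrite unfold_in /= -h'E.
rewrite (_ : \matrix_(i, j) _ = \matrix_(i < k, j < k) A (h' i) j).
  apply: A_ge0 => [i j lt_ij lt_jk|i /h'P/andP[]//].
  have /andP[_ le_hi] := h'P i (ltn_trans lt_ij lt_jk).
  have /andP[le_hj _] := h'P j lt_jk.
  apply: leq_ltn_trans le_hi (leq_trans _ le_hj).
  case: j lt_ij lt_jk {le_hj} => //= j; rewrite !ltnS leq_eqVlt.
  case/predU1P => [->//|lt_ij] lt_jk; apply: ltnW; apply: inc_f => //; exact: ltnW.
by apply/matrixP => i j; rewrite !mxE h'E.
Qed.

(** With index functions on [nat], shifting an index set is composition with [S] or [predn], without
    casts between ordinal types. *)
Definition fminor (R : comNzRingType) (M : nat -> nat -> R) k (f g : nat -> nat) :=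
  \det (\matrix_(i < k, j < k) M (f i) (g j)).

Lemma fminor_tr (R : comNzRingType) (M : nat -> nat -> R) k f g :
  fminor (fun i j => M j i) k f g = fminor M k g f.
Proof.
by rewrite /fminor -det_tr; congr (\det _); apply/matrixP => i j; rewrite !mxE.
Qed.

Lemma fminor0 (R : comNzRingType) (M : nat -> nat -> R) f g : fminor M 0 f g = 1.
Proof. exact: det_mx00. Qed.

Lemma eq_fminor (R : comNzRingType) (M M' : nat -> nat -> R) k f g f' g' :
    (forall i j, (i < k)%N -> (j < k)%N -> M (f i) (g j) = M' (f' i) (g' j)) ->
  fminor M k f g = fminor M' k f' g'.
Proof.
move=> eqM; congr (\det _); apply/matrixP => i j.
by rewrite !mxE eqM // ltn_ord.
Qed.

Lemma fminor_scale (R : comNzRingType) (d e : nat -> R) M k f g :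
  fminor (fun i j => d i * e j * M i j) k f g =
  (\prod_(i < k) d (f i)) * (\prod_(j < k) e (g j)) * fminor M k f g.
Proof.
pose D (x : nat -> R) h := diag_mx (\row_(i < k) x (h i)).
have detD x h : \det (D x h) = \prod_(i < k) x (h i).
  by rewrite det_diag; apply: eq_bigr => i _; rewrite mxE.
rewrite mulrAC -!detD -!det_mulmx; congr (\det _).
by apply/matrixP => i j; rewrite mul_mx_diag mul_diag_mx !mxE mulrAC.
Qed.

Lemma fminor_block (R : comNzRingType) (M : nat -> nat -> R) k f g :
    (forall j, (j < k)%N -> M (f 0%N) (g j.+1) = 0) ->
  fminor M k.+1 f g = M (f 0%N) (g 0%N) * fminor M k (f \o S) (g \o S).
Proof.
move=> M0; rewrite /fminor (expand_det_row _ ord0) big_ord_recl big1 => [|j _].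
  rewrite addr0 !mxE /cofactor expr0 mul1r; congr (_ * \det _).
  by apply/matrixP => i j; rewrite !mxE /= /bump !add1n.
by rewrite !mxE /= /bump add1n M0 ?mul0r.
Qed.

(** * Double partial sums *)

(** The border lets the constant of [dsum] be summed like any other entry, so that the expansion of
    partial sums applies. *)
Definition bordered (R : comNzRingType) (c : R) (N : nat -> nat -> R) i j :=
  match i, j with
  | 0%N, 0%N => c
  | i'.+1, j'.+1 => N i' j'
  | _, _ => 0
  end.

Definition dsum (R : comNzRingType) (c : R) (N : nat -> nat -> R) i j :=
  c + \sum_(p < i) \sum_(q < j) N p q.

Lemma dsumE (R : comNzRingType) (c : R) N i j :
  dsum c N i j = \sum_(p < i.+1) \sum_(q < j.+1) bordered c N p q.
Proof.
rewrite big_ord_recl; congr (_ + _).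
  by rewrite big_ord_recl big1 ?addr0.
by apply: eq_bigr => p _; rewrite big_ord_recl add0r.
Qed.

(** Differencing rows, then columns, turns the first row into [c, 0, ..., 0] and leaves [N] on the
    remaining block; the entries below [c] do not matter. *)
Lemma fminor_dsum_initial (R : comNzRingType) (c : R) N k m :
  fminor (dsum c N) k.+1 id (addn m) = c * fminor N k id (addn m).
Proof.
rewrite /fminor -(det_row_diff (fun i (j : 'I_k.+1) => dsum c N i (m + j))).
pose D i j := dsum c N i (m + j) - if i is i'.+1 then dsum c N i' (m + j) else 0.
have DE i j : D i.+1 j = \sum_(q < m + j) N i q.
  by rewrite /D /dsum big_ord_recr opprD addrACA subrr add0r addrAC subrr add0r.
(* Transposition makes [det_row_diff] act on the columns. *)
rewrite -det_tr.
rewrite (_ : _^T = \matrix_(j < k.+1, i < k.+1) D i j); last first.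
  by apply/matrixP => i j; rewrite !mxE.
rewrite -(det_row_diff (fun j (i : 'I_k.+1) => D i j)) -det_tr.
pose D' i j := D i j - if j is j'.+1 then D i j' else 0.
rewrite (_ : _^T = \matrix_(i < k.+1, j < k.+1) D' i j); last first.
  by apply/matrixP => i j; rewrite !mxE.
rewrite -/(fminor D' k.+1 id id) fminor_block => [|j _].
  congr (_ * _); first by rewrite /D' /D /dsum !big_ord0 !subr0 addr0.
  rewrite -/(fminor N k id (addn m)); apply: (eq_fminor (f' := id)) => i j _ _ /=.
  by rewrite /D' !DE addnS big_ord_recr /= addrAC subrr add0r.
by rewrite /D' /D /dsum !big_ord0 !subr0 subrr.
Qed.

(** The bound [n] carries the induction for Pascal's matrix: [dsum] raises it by one. *)
Definition tp_below (R : realDomainType) n (M : nat -> nat -> R) :=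
  forall k f g, increasing k f -> increasing k g ->
    (forall i, (i < k)%N -> (f i < n)%N) -> (forall i, (i < k)%N -> (g i < n)%N) ->
  0 < fminor M k f g.

Lemma tp_scale (R : realDomainType) n (d e : nat -> R) M :
    (forall i, 0 < d i) -> (forall i, 0 < e i) -> tp_below n M ->
  tp_below n (fun i j => d i * e j * M i j).
Proof.
move=> d0 e0 tpM k f g incf incg ltf ltg; rewrite fminor_scale.
by rewrite !mulr_gt0 ?tpM // prodr_gt0.
Qed.

Lemma increasing_gt0 k f i : increasing k f -> (0 < i < k)%N -> (0 < f i)%N.
Proof.
move=> incf /andP[i0 lt_ik].
exact: leq_ltn_trans (leq0n (f 0%N)) (incf _ _ i0 lt_ik).
Qed.

Lemma increasing_pred k f : increasing k f -> (0 < f 0)%N -> increasing k (predn \o f).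
Proof.
move=> incf f0 i j lt_ij lt_jk /=; have := incf _ _ lt_ij lt_jk.
have : (0 < f i)%N; last by lia.
by case: i lt_ij => [//|i] lt_ij; apply: increasing_gt0 incf _; lia.
Qed.

Lemma increasing_behead k f : increasing k.+1 f -> increasing k (predn \o (f \o S)).
Proof.
case: k => [|k] incf; first by [].
apply: increasing_pred => [i j lt_ij lt_jk|]; first exact: incf.
exact: increasing_gt0 incf _.
Qed.

Section Bordered.
Variables (R : realDomainType) (n : nat) (c : R) (N : nat -> nat -> R).
Hypotheses (c_gt0 : 0 < c) (tpN : tp_below n N).

Lemma fminor_bordered_gt0 k h h' :
    increasing k.+1 h -> increasing k.+1 h' -> h 0%N = 0%N -> h' 0%N = 0%N ->
    (forall i, (i < k.+1)%N -> (h i < n.+1)%N) ->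
    (forall i, (i < k.+1)%N -> (h' i < n.+1)%N) ->
  0 < fminor (bordered c N) k.+1 h h'.
Proof.
move=> inch inch' h0 h'0 lth lth'.
have gt0 f i : increasing k.+1 f -> (i < k)%N -> (0 < f i.+1)%N.
  by move=> incf lt_ik; apply: increasing_gt0 incf _.
rewrite fminor_block => [|j lt_jk]; last first.
  by rewrite h0; have := gt0 _ _ inch' lt_jk; case: (h' _).
rewrite h0 h'0 mulr_gt0 //.
rewrite (@eq_fminor _ _ N _ _ _ (predn \o (h \o S)) (predn \o (h' \o S))) /=.
  apply: tpN => [||i lt_ik|i lt_ik] /=; try exact: increasing_behead.
    by have := lth i.+1 lt_ik; have := gt0 _ _ inch lt_ik; case: (h _).
  by have := lth' i.+1 lt_ik; have := gt0 _ _ inch' lt_ik; case: (h' _).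
move=> i j lt_ik lt_jk; have := gt0 _ _ inch lt_ik; have := gt0 _ _ inch' lt_jk.
by case: (h _) => //; case: (h' _).
Qed.

(** If just one index set meets the border, the minor has a zero row or column; if neither does, it
    is a minor of [N]. *)
Lemma fminor_bordered_ge0 k h h' :
    increasing k h -> increasing k h' ->
    (forall i, (i < k)%N -> (h i < n.+1)%N) ->
    (forall i, (i < k)%N -> (h' i < n.+1)%N) ->
  0 <= fminor (bordered c N) k h h'.
Proof.
case: k => [|k] inch inch' lth lth'; first by rewrite fminor0.
have gt0 f i : increasing k.+1 f -> (0 < f 0)%N -> (i < k.+1)%N -> (0 < f i)%N.
  by case: i => // i incf _ lt_ik; apply: increasing_gt0 incf _.
have [h0|h0] := posnP (h 0%N); have [h'0|h'0] := posnP (h' 0%N).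
- by rewrite ltW // fminor_bordered_gt0.
- rewrite /fminor (expand_det_row _ ord0) big1 // => j _; rewrite mxE h0.
  by have := gt0 _ _ inch' h'0 (ltn_ord j); case: (h' _) => //=; rewrite mul0r.
- rewrite /fminor (expand_det_col _ ord0) big1 // => j _; rewrite mxE h'0.
  by have := gt0 _ _ inch h0 (ltn_ord j); case: (h _) => //=; rewrite mul0r.
rewrite (@eq_fminor _ _ N _ _ _ (predn \o h) (predn \o h')) /=.
  apply/ltW/tpN => [||i lt_ik|i lt_ik] /=; try exact: increasing_pred.
    by have := lth i lt_ik; have := gt0 _ _ inch h0 lt_ik; case: (h _).
  by have := lth' i lt_ik; have := gt0 _ _ inch' h'0 lt_ik; case: (h' _).
move=> i j lt_ik lt_jk; have := gt0 _ _ inch h0 lt_ik.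
by have := gt0 _ _ inch' h'0 lt_jk; case: (h _) => //; case: (h' _).
Qed.

Lemma tp_dsum : tp_below n.+1 (dsum c N).
Proof.
move=> k f g incf incg ltf ltg.
case: k => [|k] in incf incg ltf ltg *; first by rewrite fminor0.
(* A positive term of the expansion: every index but the first is kept, and the
   first one is moved to 0, so that both index sets contain the border. *)
pose z f i := if i is i'.+1 then f i'.+1 else 0%N : nat.
have incz h : increasing k.+1 h -> increasing k.+1 (z h).
  by move=> inch [|i] [|j] //= lt_ij lt_jk; [exact: increasing_gt0 inch _|exact: inch].
have zP h i : increasing k.+1 h -> (i < k.+1)%N -> (prev_bound h i <= z h i <= h i)%N.
  by move=> inch; case: i => //= i lt_ik; rewrite inch /=.
have le_z h i : (z h i <= h i)%N by case: i => /=.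
(* [C] carries only the column sums, so that columns and rows are expanded separately. *)
pose C i j := \sum_(q < j.+1) bordered c N i q.
have le_C h : increasing k.+1 h -> (forall i, (i < k.+1)%N -> (h i <= f i)%N) ->
    fminor (bordered c N) k.+1 h (z g) <= fminor C k.+1 h g.
  move=> inch le_h; rewrite -[X in X <= _]fminor_tr -[X in _ <= X]fminor_tr.
  apply: (det_partial_sums_ge (A := fun q (i : 'I_k.+1) => bordered c N (h i) q)).
  - exact: incg.
  - move=> h1 inch1 le_h1; rewrite -/(fminor (fun q p => bordered c N p q) _ h1 h).
    rewrite fminor_tr; apply: fminor_bordered_ge0 => // i lt_ik.
      exact: leq_ltn_trans (le_h _ lt_ik) (ltf _ lt_ik).
    exact: leq_ltn_trans (le_h1 _ lt_ik) (ltg _ lt_ik).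
  - by move=> i; apply: zP.
have lt_z h i : (forall i, (i < k.+1)%N -> (h i < n.+1)%N) -> (i < k.+1)%N ->
    (z h i < n.+1)%N.
  by move=> lth lt_ik; apply: leq_ltn_trans (lth _ lt_ik).
have : 0 < fminor C k.+1 (z f) g.
  apply: lt_le_trans (le_C _ _ _) => //; first last.
  - exact: incz.
  apply: fminor_bordered_gt0 => //; try exact: incz; move=> i; exact: lt_z.
move/lt_le_trans; apply.
rewrite (@eq_fminor _ (dsum c N) (fun i j => \sum_(p < i.+1) C p j) k.+1 f g f g).
  apply: (det_partial_sums_ge (A := fun p (j : 'I_k.+1) => C p (g j))) => //.
  - move=> h inch le_h; apply: le_trans (le_C _ _ _) => //.
    apply: fminor_bordered_ge0 => //; try exact: incz.
      by move=> i lt_ik; apply: leq_ltn_trans (le_h _ lt_ik) (ltf _ lt_ik).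
    by move=> i; apply: lt_z.
  - by move=> i; apply: zP.
by move=> i j _ _; rewrite dsumE.
Qed.

End Bordered.
Lemma tp_below_dsum (R : realDomainType) (c : R) N :
    0 < c -> (forall n, tp_below n N) -> forall n, tp_below n (dsum c N).
Proof.
move=> c0 tpN [|n]; last exact: tp_dsum.
by case=> [|k] f g _ _ ltf _; [rewrite fminor0 | have := ltf 0%N isT].
Qed.

Lemma dsum_recr (R : comNzRingType) (c : R) N i j :
  dsum c N i.+1 j.+1 =
  dsum c N i.+1 j + dsum c N i j.+1 - dsum c N i j + N i j.
Proof.
rewrite /dsum !(big_ord_recr i) /= (big_ord_recr j) /=; ring.
Qed.

(** * The matrix T *)

Definition pascal (R : nzRingType) i j : R := 'C(i + j, i)%:R.

(** For this [N] the recurrence [dsum_recr] collapses to Pascal's rule. *)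
Lemma pascal_dsum (R : comNzRingType) i j :
  pascal R i j = dsum 1 (@pascal R) i j.
Proof.
elim: i j => [|i IHi] j; first by rewrite /dsum big_ord0 addr0 /pascal bin0.
elim: j => [|j IHj].
  by rewrite /dsum big1 ?addr0 => [|p _]; rewrite ?big_ord0 // /pascal addn0 binn.
rewrite dsum_recr -IHj -!IHi subrK /pascal !addSn !addnS !binS !natrD; ring.
Qed.

Lemma tp_pascal (R : realDomainType) n : tp_below n (@pascal R).
Proof.
elim: n => [|n IHn].
  by case=> [|k] f g _ _ ltf _; [rewrite fminor0 | have := ltf 0%N isT].
move=> k f g incf incg ltf ltg.
rewrite (eq_fminor (M' := dsum 1 (@pascal R)) (f' := f) (g' := g)) => [|*].
  exact: (tp_dsum ltr01 IHn).
exact: pascal_dsum.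
Qed.

Lemma pascal_initial (R : comNzRingType) k m :
  fminor (@pascal R) k id (addn m) = 1.
Proof.
elim: k => [|k IHk]; first exact: fminor0.
rewrite (eq_fminor (M' := dsum 1 (@pascal R)) (f' := id) (g' := addn m)) => [|*].
  by rewrite fminor_dsum_initial IHk mulr1.
exact: pascal_dsum.
Qed.

(** * The symmetric matrix of two sequences with Wronskian 1 *)

Section SymmetricMatrix.
Variables (F : realFieldType) (al be : nat -> F).
Hypothesis al_gt0 : forall i, 0 < al i.
Hypothesis wronskian : forall i, al i * be i.+1 - be i * al i.+1 = 1.
Hypothesis be0 : be 0%N = al 1%N.

Let al_neq0 i : al i != 0. Proof. exact: lt0r_neq0. Qed.

Definition weight i := (al i * al i.+1)^-1.

Definition inner_mx :=
  dsum (al 0%N) (fun p q => al p.+1 * al q.+1 * pascal F p q).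

Definition outer_mx i j :=
  al i * al j * dsum (al 0%N)^-1 (fun p q => weight p * weight q * inner_mx p q) i j.

Lemma tp_outer_mx n : tp_below n outer_mx.
Proof.
have w_gt0 i : 0 < weight i by rewrite invr_gt0 mulr_gt0.
apply: tp_scale => //; apply: tp_below_dsum => [|{}n]; first by rewrite invr_gt0.
apply: tp_scale => //; apply: tp_below_dsum => // {}n.
apply: (tp_scale (d := al \o S) (e := al \o S)) => [i|i|] /=; rewrite ?al_gt0 //.
exact: tp_pascal.
Qed.

(** Each [weight] is a product of two inverses; together they cancel the [k + 2] outer and the [k]
    inner factors. *)
Lemma prod_al_weight m k :
  (\prod_(i < k.+2) al (m + i)) * (\prod_(i < k.+1) weight (m + i)) *
    (\prod_(i < k) al (m + i).+1) = 1.
Proof.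
elim: k => [|k IHk].
  by rewrite !big_ord_recr !big_ord0 /= !mul1r mulr1 addn0 addn1 mulfV // mulf_neq0.
rewrite (big_ord_recr k) (big_ord_recr k.+1) (big_ord_recr k.+2) /=.
move: IHk; set x := \prod_(i < k.+2) _; set y := \prod_(i < k.+1) _.
set z := \prod_(i < k) _ => IHk; rewrite -[RHS]IHk /weight !addnS.
by field; rewrite !al_neq0.
Qed.

(** Each of the two summations costs one row and one column, hence the size [k.+2]. The constants
    [(al 0)^-1] and [al 0] cancel. *)
Lemma outer_mx_initial k m : fminor outer_mx k.+2 id (addn m) = 1.
Proof.
rewrite fminor_scale fminor_dsum_initial fminor_scale fminor_dsum_initial.
rewrite (fminor_scale (al \o S) (al \o S)) pascal_initial mulr1 /=.
have := prod_al_weight m k; have := prod_al_weight 0 k.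
rewrite (eq_bigr (fun i : 'I__ => al i)) //.
rewrite [X in _ * X * _](eq_bigr (fun i : 'I__ => weight i)) //.
rewrite [X in _ * X](eq_bigr (fun i : 'I__ => al i.+1)) //.
set x1 := \prod_(i < _) _; set x2 := \prod_(i < _) _; set x3 := \prod_(i < _) _.
set y1 := \prod_(i < _) _; set y2 := \prod_(i < _) _; set y3 := \prod_(i < _) _.
move=> x_eq y_eq; have al0 := al_neq0 0.
rewrite [LHS](_ : _ = (x1 * x2 * x3) * (y1 * y2 * y3)); last by field.
by rewrite x_eq y_eq mulr1.
Qed.

(** In [i] this is a combination of [al] and [be] with value 0 at [p + 1] and, by the Wronskian
    identity, 1 at [p + 2]. *)
Definition green i p := al p.+1 * be i - be p.+1 * al i.

(** By the Wronskian identity, [weight] is the forward difference of [be i / al i]. *)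
Lemma sum_weight i :
  \sum_(p < i) weight p = be i / al i - be 0%N / al 0%N.
Proof.
elim: i => [|i IHi]; first by rewrite big_ord0 subrr.
rewrite big_ord_recr /= IHi /weight -[X in _ + X]mul1r -(wronskian i).
by field; rewrite !al_neq0.
Qed.

(** Replaces two nested sums by one with a division-free kernel. The induction rests on [al i *
    green i.+1 p = al i.+1 * green i p + al p.+1]. *)
Lemma green_sum (f : nat -> F) i :
  \sum_(p < i) green i p * f p =
  al i * \sum_(p < i) weight p * (\sum_(q < p) al q.+1 * f q).
Proof.
elim: i => [|i IHi]; first by rewrite !big_ord0 mulr0.
rewrite !big_ord_recr /= (_ : green i.+1 i = 0) ?mul0r ?addr0; last first.
  by rewrite /green mulrC subrr.
apply: (mulfI (al_neq0 i)).
rewrite [RHS](_ : _ = al i.+1 * (\sum_(p < i) green i p * f p) +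
                   \sum_(q < i) al q.+1 * f q); last first.
  by rewrite IHi /weight; field; rewrite !al_neq0.
rewrite !mulr_sumr -big_split /=; apply: eq_bigr => p _.
by rewrite -[al p.+1 * f p]mul1r -(wronskian i) /green; ring.
Qed.

(** A division-free form, hence integral for integral sequences. The quadratic part comes from the
    constants of the two sums, the rest from [green_sum] in each variable. *)
Lemma outer_mxE i j :
  outer_mx i j =
  be 1%N * al i * al j - al 1%N * (al i * be j + be i * al j)
  + al 0%N * be i * be j
  + \sum_(p < i) green i p * (\sum_(q < j) green j q * pascal F p q).
Proof.
pose D p q := \sum_(p' < p) \sum_(q' < q) al p'.+1 * al q'.+1 * pascal F p' q'.
have -> : \sum_(p < i) green i p * (\sum_(q < j) green j q * pascal F p q) =
    al i * al j * \sum_(p < i) \sum_(q < j) weight p * weight q * D p q.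
  rewrite (green_sum (fun p => \sum_(q < j) green j q * pascal F p q)) -mulrA.
  congr (_ * _); rewrite mulr_sumr; apply: eq_bigr => p _.
  under [X in weight _ * X]eq_bigr => p' _.
    rewrite (green_sum (fun q => pascal F p' q)) mulrCA.
    rewrite mulr_sumr; over.
  rewrite -mulr_sumr mulrCA exchange_big /=; congr (_ * _).
  rewrite mulr_sumr; apply: eq_bigr => q _.
  rewrite /D -mulrA; congr (_ * _); rewrite mulr_sumr; apply: eq_bigr => p' _.
  rewrite mulrCA; congr (_ * _); rewrite mulr_sumr; apply: eq_bigr => q' _.
  by rewrite mulrA.
have -> : outer_mx i j = al i * al j * ((al 0%N)^-1 +
    al 0%N * ((\sum_(p < i) weight p) * (\sum_(q < j) weight q)) +
    \sum_(p < i) \sum_(q < j) weight p * weight q * D p q).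
  rewrite /outer_mx /dsum -addrA; congr (_ * (_ + _)).
  rewrite mulr_suml mulr_sumr -big_split; apply: eq_bigr => p _ /=.
  rewrite !mulr_sumr -big_split; apply: eq_bigr => q _ /=.
  by rewrite /inner_mx /dsum -/(D p q); ring.
rewrite mulrDr !sum_weight be0; congr (_ + _).
(* The Wronskian identity at 0, solved for [be 1]. *)
have -> : be 1%N = (1 + al 1%N ^+ 2) / al 0%N.
  by rewrite -(wronskian 0) be0; field.
by field; rewrite !al_neq0.
Qed.

Lemma outer_mxC i j : outer_mx i j = outer_mx j i.
Proof.
rewrite !outer_mxE; congr (_ + _); first by ring.
under eq_bigr => p _ do rewrite mulr_sumr.
rewrite exchange_big /=; apply: eq_bigr => q _; rewrite mulr_sumr.
apply: eq_bigr => p _; rewrite mulrCA; congr (_ * (_ * _)).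
by rewrite /pascal addnC -bin_sub ?leq_addl // addnK.
Qed.

Lemma outer_mx0 j : outer_mx 0 j = al j.
Proof. by rewrite /outer_mx /dsum big_ord0 addr0 mulrAC mulfV // mul1r. Qed.

(** The kernel sum vanishes, and the quadratic part is [be j] times the Wronskian at 0. *)
Lemma outer_mx1 j : outer_mx 1 j = be j.
Proof.
rewrite outer_mxE big_ord1 (_ : green 1 0 = 0) ?mul0r; last first.
  by rewrite /green mulrC subrr.
by rewrite -[RHS]mul1r -(wronskian 0) be0; ring.
Qed.

End SymmetricMatrix.

(** * Minors indexed by sets of ordinals *)

Definition index_seq n (I : {set 'I_n}) := [seq val i | i <- enum I].

Lemma index_seq_sorted n (I : {set 'I_n}) : sorted ltn (index_seq I).
Proof.
apply: (subseq_sorted ltn_trans _ (iota_ltn_sorted 0 n)).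
by rewrite -val_enum_ord map_subseq // enumT; apply: filter_subseq.
Qed.

Lemma size_index_seq n (I : {set 'I_n}) : size (index_seq I) = #|I|.
Proof. by rewrite size_map -cardE. Qed.

Lemma index_seq_increasing n (I : {set 'I_n}) k :
  #|I| = k -> increasing k (nth 0%N (index_seq I)).
Proof.
move=> cardI i j lt_ij lt_jk.
apply: (sorted_ltn_nth ltn_trans 0%N (index_seq_sorted I)) => //;
  rewrite inE size_index_seq cardI //; exact: ltn_trans lt_jk.
Qed.

Lemma index_seq_lt n (I : {set 'I_n}) k i :
  #|I| = k -> (i < k)%N -> (nth 0%N (index_seq I) i < n)%N.
Proof.
move=> cardI lt_ik.
have /mapP[x _ ->] : nth 0%N (index_seq I) i \in index_seq I.
  by rewrite mem_nth // size_index_seq cardI.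
exact: ltn_ord.
Qed.

(** Ranges count from 1 and ordinals from 0, hence [p.+1] against [iota p]. *)
Lemma index_seq_range n p q :
  (q <= n)%N -> index_seq (index_range n p.+1 q) = iota p (q - p).
Proof.
move=> le_qn.
apply: (irr_sorted_eq ltn_trans ltnn (index_seq_sorted _) (iota_ltn_sorted _ _)).
move=> x; rewrite mem_iota; apply/mapP/idP => [[i]|].
  by rewrite mem_enum inE => ip -> /=; lia.
move=> x_in; have lt_xn : (x < n)%N by lia.
by exists (Ordinal lt_xn); rewrite // mem_enum inE /=; lia.
Qed.

Lemma card_range n p q : (q <= n)%N -> #|index_range n p.+1 q| = (q - p)%N.
Proof. by move=> le_qn; rewrite -size_index_seq index_seq_range // size_iota. Qed.

Lemma minor_corner (R : comNzRingType) (T : nat -> nat -> R) n (I J : {set 'I_n}) :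
    #|I| = #|J| ->
  minor (corner T n) I J =
  fminor (fun i j => T i.+1 j.+1) #|I| (nth 0%N (index_seq I)) (nth 0%N (index_seq J)).
Proof.
move=> cardIJ; congr (\det _); apply/matrixP => i j; rewrite !mxE.
rewrite (enum_val_nth (enum_val i)) -!(nth_map _ 0%N val) -?cardE ?ltn_ord //.
by rewrite -cardIJ.
Qed.

Lemma minor_corner_range (R : comNzRingType) (T : nat -> nat -> R) n k :
    (k <= n)%N ->
  minor (corner T n) (index_range n (n - k + 1) n) (index_range n 1 k) =
  fminor (fun i j => T i.+1 j.+1) k (addn (n - k)) id.
Proof.
move=> le_kn; rewrite addn1.
have cardI : #|index_range n (n - k).+1 n| = k by rewrite card_range // subKn.
have cardJ : #|index_range n 1 k| = k by rewrite card_range ?subn0.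
rewrite minor_corner cardI ?cardJ // !index_seq_range // subKn // subn0.
by apply: eq_fminor => i j lt_ik lt_jk; rewrite !nth_iota.
Qed.

(** Row [n] and column 1 fix one end of each range; equal cardinality then ties the other two ends
    together. *)
Lemma solid_lower_left n (I J : {set 'I_n}) :
    #|I| = #|J| -> solid I -> solid J -> lower_left I J ->
  exists2 k, (0 < k <= n)%N & I = index_range n (n - k + 1) n /\ J = index_range n 1 k.
Proof.
move=> cardIJ [p [q defI]] [p' [q' defJ]] [[i Ii i_n] [j Jj j_1]].
have n_gt0 : (0 < n)%N by rewrite -i_n.
move: Ii Jj; rewrite {1}defI {1}defJ !inE i_n j_1 => /andP[le_pn le_nq] /andP[le_p1 le_q].
(* [q'] may exceed [n]. *)
exists (minn q' n); first by rewrite leq_min le_q n_gt0 geq_minr.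
have eqJ : J = index_range n 1 (minn q' n).
  by rewrite defJ; apply/setP => x; rewrite !inE; have := ltn_ord x; lia.
split=> //.
(* [p] may be 0, which selects the same rows as 1. *)
have eqI : I = index_range n p.-1.+1 n.
  by rewrite defI; apply/setP => x; rewrite !inE; have := ltn_ord x; lia.
move: cardIJ; rewrite {1}eqI {1}eqJ !card_range ?geq_minr // subn0 => <-.
rewrite subKn ?addn1 //; lia.
Qed.

(** * Transfer from the rationals to the integers *)

Theorem theorem4p11 (a b : nat -> nat)
    (a_gt0 : forall n : nat, (1 <= n)%N -> (0 < a n)%N)
    (b_gt0 : forall n : nat, (1 <= n)%N -> (0 < b n)%N)
    (b1a2 : b 1%N = a 2%N)
    (ab1 : forall n : nat, (1 <= n)%N ->
       (a n)%:Z * (b n.+1)%:Z - (b n)%:Z * (a n.+1)%:Z = 1) :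
  exists T : nat -> nat -> int,
    (forall i j : nat, (1 <= i)%N -> (1 <= j)%N ->
       exists2 m : nat, (0 < m)%N & T i j = m%:Z) /\
    (forall i j : nat, (1 <= i)%N -> (1 <= j)%N -> T i j = T j i) /\
    (forall n : nat, (1 <= n)%N ->
       (T 1%N n = (a n)%:Z /\ T n 1%N = (a n)%:Z) /\
       (T 2%N n = (b n)%:Z /\ T n 2%N = (b n)%:Z)) /\
    (forall n : nat, (1 <= n)%N -> totally_positive (corner T n)) /\
    (forall n : nat, (1 <= n)%N ->
       [/\ minor (corner T n) (index_range n n n) (index_range n 1 1) = T n 1%N
             /\ T n 1%N = (a n)%:Z,
           forall k : nat, (2 <= k <= n)%N ->
             minor (corner T n) (index_range n (n - k + 1) n) (index_range n 1 k)
               = 1,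
           (2 <= n)%N -> \det (corner T n) = 1
         & forall I J : {set 'I_n}, #|I| = #|J| -> solid I -> solid J ->
             lower_left I J -> (I, J) <> (index_range n n n, index_range n 1 1) ->
             minor (corner T n) I J = 1]).
Proof.
pose A i : int := (a i.+1)%:Z; pose B i : int := (b i.+1)%:Z.
pose g i p := A p.+1 * B i - B p.+1 * A i.
(* The right-hand side of [outer_mxE] over [int]; the predecessors shift indices from base 1 to base
   0. *)
pose T i j := B 1%N * A i.-1 * A j.-1 - A 1%N * (A i.-1 * B j.-1 + B i.-1 * A j.-1)
  + A 0%N * B i.-1 * B j.-1
  + \sum_(p < i.-1) g i.-1 p * (\sum_(q < j.-1) g j.-1 q * pascal int p q).
pose al i : rat := (A i)%:~R; pose be i : rat := (B i)%:~R.
have al_gt0 i : 0 < al i by rewrite ltr0z; apply: a_gt0.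
have wr i : al i * be i.+1 - be i * al i.+1 = 1.
  by rewrite /al /be /A /B -!intrM -intrB ab1.
have be0 : be 0%N = al 1%N by rewrite /be /B b1a2.
have TE i j : (T i.+1 j.+1)%:~R = outer_mx al i j.
  rewrite (outer_mxE al_gt0 wr be0) /T /= intrD rmorph_sum /=; congr (_ + _).
    by rewrite !(intrB, intrD, intrM).
  apply: eq_bigr => p _; rewrite intrM rmorph_sum /=; congr (_ * _).
    by rewrite intrB !intrM.
  apply: eq_bigr => q _; rewrite intrM /pascal rmorph_nat; congr (_ * _).
  by rewrite intrB !intrM.
have T_inj i j (m : int) : outer_mx al i j = m%:~R -> T i.+1 j.+1 = m.
  by move=> eq_m; apply: (@intr_inj rat); rewrite TE.
have minorE n (I J : {set 'I_n}) : #|I| = #|J| ->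
    (minor (corner T n) I J)%:~R =
    fminor (outer_mx al) #|I| (nth 0%N (index_seq I)) (nth 0%N (index_seq J)).
  move=> cardIJ.
  rewrite minor_corner // -det_map_mx; congr (\det _); apply/matrixP => i j.
  by rewrite !mxE /= TE.
have T_C i j : T i.+1 j.+1 = T j.+1 i.+1.
  by apply: T_inj; rewrite TE (outer_mxC al_gt0 wr be0).
have T_1 j : T 1%N j.+1 = A j by apply: T_inj; rewrite (outer_mx0 al_gt0).
have T_2 j : T 2%N j.+1 = B j by apply: T_inj; rewrite (outer_mx1 al_gt0 wr be0).
have minor_range n k : (2 <= k <= n)%N ->
    minor (corner T n) (index_range n (n - k + 1) n) (index_range n 1 k) = 1.
  case/andP; case: k => [|[|k]] // _ le_kn; rewrite minor_corner_range //.
  apply: (@intr_inj rat); rewrite -det_map_mx -(outer_mx_initial al_gt0 k (n - k.+2)).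
  (* Here the columns are initial and the rows shifted, so [outer_mx_initial] is used transposed,
     through the symmetry of the matrix. *)
  rewrite -fminor_tr; congr (\det _); apply/matrixP => i j; rewrite !mxE /= TE.
  by rewrite (outer_mxC al_gt0 wr be0).
exists T; split=> [[|i] [|j] // _ _|].
  have : 0 < T i.+1 j.+1.
    rewrite -(ltr0z rat) TE.
    (* An entry is a 1 by 1 minor. *)
    have := @tp_outer_mx _ _ al_gt0 (i + j).+1 1 (fun=> i) (fun=> j).
    rewrite /fminor det_mx11 mxE; apply=> [x []|x []|x _|x _] //; lia.
  by case: (T _ _) => // m m_gt0; exists m.
split=> [[|i] [|j] //|].
split=> [[|n] // _|]; first by rewrite !(T_C n) T_1 T_2.
split=> [n _ I J cardIJ|n n_gt0].
  rewrite -(ltr0z rat) minorE //; apply: (tp_outer_mx al_gt0 (n := n)).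
  - exact: index_seq_increasing.
  - exact: index_seq_increasing.
  - by move=> i; apply: index_seq_lt.
  - by move=> i; apply: index_seq_lt.
split=> [|k|n_ge2|I J cardIJ solI solJ llIJ neIJ].
- case: n n_gt0 => // n _; rewrite (T_C n) T_1; split=> //.
  have := minor_corner_range T (ltn0Sn n); rewrite subSS subn0 addn1 => ->.
  by rewrite /fminor det_mx11 mxE addn0 T_C T_1.
- exact: minor_range.
(* The case [k = n] is the whole corner. *)
- have /minor_range : (2 <= n <= n)%N by rewrite n_ge2 /=.
  rewrite minor_corner_range // subnn => <-; exact: congr1.
have [k /andP[k_gt0 le_kn] [defI defJ]] := solid_lower_left cardIJ solI solJ llIJ.
rewrite defI defJ minor_range // le_kn andbT ltn_neqAle k_gt0 andbT.
(* The excluded pair is the case [k = 1]. *)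
by apply/eqP => k1; apply: neIJ; rewrite defI defJ -k1 subnK.
Qed.
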